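(* Let $F=\frac1n\sum_{i=1}^nF_i$. Assume that there is $\widehat\ell>0$ such that for all $x\in\mathbb{R}^d$, with $x^*=\mathrm{proj}_{X^*}(x)$, $$\frac1n\sum_{i=1}^n\|F_i(x)-F_i(x^* )\|^2\le\widehat\ell\,\langle F(x)-F(x^* ),x-x^*\rangle,$$ and that $X^*=\{x^*\}$ is a singleton. Then SAGA-SGDA satisfies the key parametric assumption with $A=\widehat\ell$, $B=2$, $\sigma_k^2=\frac1n\sum_{i=1}^n\|F_i(w_i^k)-F_i(x^* )\|^2$, $C=\frac{\widehat\ell}{2n}$, $\rho=\frac1n$, $D_1=D_2=0$.
   Context: Norms and inner products on $\mathbb{R}^d$ are Euclidean. $F,F_1,\dots,F_n:\mathbb{R}^d\to\mathbb{R}^d$ are operators and $R:\mathbb{R}^d\to\mathbb{R}\cup\{+\infty\}$ is a proper lower semicontinuous convex function. $X^*$ is the (nonempty) set of solutions of the regularized variational inequality: find $x^*\in\mathbb{R}^d$ with $\langle F(x^* ),x-x^*\rangle+R(x)-R(x^* )\ge0$ for all $x\in\mathbb{R}^d$. $\mathrm{proj}_{X^*}(x)=\arg\min_{y\in X^*}\|y-x\|$. SAGA-SGDA, with $\gamma>0$ and $w_i^0=x^0$ for all $i$: at each iteration $k\ge0$ draw $j_k$ uniformly from $\{1,\dots,n\}$ (freshly), set $$g^k=F_{j_k}(x^k)-F_{j_k}(w_{j_k}^k)+\frac1n\sum_{i=1}^nF_i(w_i^k),$$ $w_{j_k}^{k+1}=x^k$, $w_i^{k+1}=w_i^k$ for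 $i\ne j_k$, and $x^{k+1}=\mathrm{prox}_{\gamma R}(x^k-\gamma g^k)$, where $\mathrm{prox}_{\gamma R}(x)=\arg\min_{y}\{R(y)+\|y-x\|^2/(2\gamma)\}$. Put $x^{*,k}=\mathrm{proj}_{X^*}(x^k)$ and $g^{*,k}=F(x^{*,k})$. $\mathbb{E}_k[\cdot]$ is the expectation with respect to the randomness at iteration $k$, i.e. conditional on everything generated before iteration $k$ (in particular on $x^k$ and the $w_i^k$). Key parametric assumption (with constants $A,B,C,D_1,D_2\ge0$, $\rho\in(0,1]$ and nonnegative variables $\sigma_k$): for all $k\ge0$, $\mathbb{E}_k[g^k]=F(x^k)$ and $$\mathbb{E}_k\|g^k-g^{*,k}\|^2\le2A\langle F(x^k)-g^{*,k},x^k-x^{*,k}\rangle+B\sigma_k^2+D_1,$$ $$\mathbb{E}_k[\sigma_{k+1}^2]\le2C\langle F(x^k)-g^{*,k},x^k-x^{*,k}\rangle+(1-\rho)\sigma_k^2+D_2.$$ *)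

(* Defs.v *)
From HB Require Import structures.
From mathcomp Require Import all_boot all_order all_algebra.
From mathcomp Require Import all_classical all_reals all_analysis.
Set Implicit Arguments.
Unset Strict Implicit.
Unset Printing Implicit Defensive.
Import Order.TTheory GRing.Theory Num.Theory.
Import numFieldNormedType.Exports.
Local Open Scope classical_set_scope.
Local Open Scope ring_scope.

(* The library norm on 'rV[R]_d is the sup norm, so the Euclidean structure is
   defined here. The topology on 'rV[R]_d, used for lower semicontinuity, is
   the same for both norms. *)
Definition dotp (R : realType) (d : nat) (u v : 'rV[R]_d) : R :=
  \sum_(i < d) u 0 i * v 0 i.

Definition norm2 (R : realType) (d : nat) (u : 'rV[R]_d) : R :=
  Num.sqrt (dotp u u).

Definition proper_fun (R : realType) (d : nat) (r : 'rV[R]_d -> \bar R) : Prop :=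
  (forall x, (-oo < r x)%E) /\ (exists x, (r x < +oo)%E).

(* [convex_function] of the library only covers real-valued functions. *)
Definition convex_efun (R : realType) (d : nat) (r : 'rV[R]_d -> \bar R) : Prop :=
  forall (x y : 'rV[R]_d) (t : R), 0 < t < 1 ->
    (r (t *: x + (1 - t) *: y)%R <= t%:E * r x + (1 - t)%:E * r y)%E.

(* Solutions of the regularized variational inequality. When r is proper, a
   point xs with r xs = +oo is never a solution: for x with r x finite the
   right-hand side is -oo. So +oo - +oo never matters at a solution. *)
Definition vi_solutions (R : realType) (d : nat) (F : 'rV[R]_d -> 'rV[R]_d)
    (r : 'rV[R]_d -> \bar R) : set 'rV[R]_d :=
  [set xs | forall x, (0 <= (dotp (F xs) (x - xs)%R)%:E + r x - r xs)%E].

(* Both argmins are chosen among all minimizers; the default value x is used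
   only when no minimizer exists. *)
Definition set_proj (R : realType) (d : nat) (X : set 'rV[R]_d) (x : 'rV[R]_d) :
    'rV[R]_d :=
  xget x [set y | X y /\ forall z, X z -> norm2 (y - x) <= norm2 (z - x)].

Definition prox (R : realType) (d : nat) (gamma : R) (r : 'rV[R]_d -> \bar R)
    (x : 'rV[R]_d) : 'rV[R]_d :=
  let obj y := (r y + (norm2 (y - x)%R ^+ 2 / (2 * gamma))%:E)%E in
  xget x [set y | forall z, (obj y <= obj z)%E].

Definition mean_op (R : realType) (d n : nat)
    (Fs : 'I_n -> 'rV[R]_d -> 'rV[R]_d) (x : 'rV[R]_d) : 'rV[R]_d :=
  n%:R^-1 *: \sum_(i < n) Fs i x.

Definition saga_estimator (R : realType) (d n : nat)
    (Fs : 'I_n -> 'rV[R]_d -> 'rV[R]_d) (x : 'rV[R]_d) (w : 'I_n -> 'rV[R]_d)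
    (j : 'I_n) : 'rV[R]_d :=
  Fs j x - Fs j (w j) + n%:R^-1 *: \sum_(i < n) Fs i (w i).

(* The pair (x^k, (w_i^k)_i) produced by SAGA-SGDA from the sampled indices
   js 0, js 1, ..., js k.-1. *)
Fixpoint saga_state (R : realType) (d n : nat)
    (Fs : 'I_n -> 'rV[R]_d -> 'rV[R]_d) (r : 'rV[R]_d -> \bar R) (gamma : R)
    (x0 : 'rV[R]_d) (js : nat -> 'I_n) (k : nat) :
    'rV[R]_d * ('I_n -> 'rV[R]_d) :=
  match k with
  | 0%N => (x0, fun=> x0)
  | k'.+1 =>
      let: (x, w) := saga_state Fs r gamma x0 js k' in
      (prox gamma r (x - gamma *: saga_estimator Fs x w (js k')),
       fun i => if i == js k' then x else w i)
  end.

Section Saga.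
Variables (R : realType) (d n : nat) (T : Type).
Variables (Fs : 'I_n -> 'rV[R]_d -> 'rV[R]_d) (r : 'rV[R]_d -> \bar R).
Variables (gamma : R) (x0 : 'rV[R]_d) (j : nat -> T -> 'I_n).

Definition saga_x (k : nat) (omega : T) : 'rV[R]_d :=
  (saga_state Fs r gamma x0 (j ^~ omega) k).1.

Definition saga_w (k : nat) (omega : T) : 'I_n -> 'rV[R]_d :=
  (saga_state Fs r gamma x0 (j ^~ omega) k).2.

Definition saga_g (k : nat) (omega : T) : 'rV[R]_d :=
  saga_estimator Fs (saga_x k omega) (saga_w k omega) (j k omega).

Definition saga_sigma (xstar : 'rV[R]_d) (k : nat) (omega : T) : R :=
  Num.sqrt (n%:R^-1 *
    \sum_(i < n) norm2 (Fs i (saga_w k omega i) - Fs i xstar) ^+ 2).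

(* The sigma-algebra generated by the draws of iterations 0, ..., k-1. As x0 is
   deterministic, these draws determine everything generated before
   iteration k. *)
Definition history (k : nat) : set (set T) :=
  <<s [set E | exists l (A : set 'I_n), (l < k)%N /\ E = j l @^-1` A] >>.

End Saga.

Record iid_uniform (dT : measure_display) (T : measurableType dT)
    (R : realType) (P : probability T R) (n : nat) (j : nat -> T -> 'I_n) :
    Prop := IidUniform {
  draw_measurable : forall k (A : set 'I_n), measurable (j k @^-1` A);
  draw_uniform : forall k (i : 'I_n), P (j k @^-1` [set i]) = (n%:R^-1)%:E;
  draw_independent : forall (s : seq nat) (A : nat -> set 'I_n), uniq s ->
    P (\bigcap_(k in [set` s]) (j k @^-1` A k)) =
    (\prod_(k <- s) P (j k @^-1` A k))%E
}.

(* Y is a version of E[X | G]. *)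
Record is_cond_expectation (dT : measure_display) (T : measurableType dT)
    (R : realType) (P : probability T R) (G : set (set T)) (X Y : T -> R) :
    Prop := IsCondExpectation {
  cond_exp_dom : P.-integrable setT (EFin \o X);
  cond_exp_integrable : P.-integrable setT (EFin \o Y);
  cond_exp_measurable : forall B : set R, measurable B -> G (Y @^-1` B);
  cond_exp_integral : forall E : set T, G E ->
    (\int[P]_(omega in E) (Y omega)%:E = \int[P]_(omega in E) (X omega)%:E)%E
}.

(* E[X | G] <= b almost surely; versions of E[X | G] agree almost surely, so
   the choice of Y is immaterial. *)
Definition cond_exp_le (dT : measure_display) (T : measurableType dT)
    (R : realType) (P : probability T R) (G : set (set T)) (X b : T -> R) :
    Prop :=
  exists2 Y : T -> R, is_cond_expectation P G X Y &
    {ae P, forall omega, Y omega <= b omega}.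

(* G k is the information available before iteration k, so that E_k is
   E[ . | G k]. *)
Definition key_parametric_assumption (dT : measure_display)
    (T : measurableType dT) (R : realType) (P : probability T R)
    (G : nat -> set (set T)) (d : nat) (F : 'rV[R]_d -> 'rV[R]_d)
    (X : set 'rV[R]_d) (x g : nat -> T -> 'rV[R]_d) (sigma : nat -> T -> R)
    (A B C D1 D2 rho : R) : Prop :=
  let xs k omega := set_proj X (x k omega) in
  let gs k omega := F (xs k omega) in
  let gap k omega :=
    dotp (F (x k omega) - gs k omega) (x k omega - xs k omega) in
  [/\ [/\ 0 <= A, 0 <= B, 0 <= C, 0 <= D1 & 0 <= D2],
      0 < rho <= 1,
      forall k omega, 0 <= sigma k omega &
      forall k,
        [/\ forall i : 'I_d, is_cond_expectation P (G k)
              (fun omega => g k omega 0 i) (fun omega => F (x k omega) 0 i),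
            cond_exp_le P (G k)
              (fun omega => norm2 (g k omega - gs k omega) ^+ 2)
              (fun omega => 2 * A * gap k omega + B * sigma k omega ^+ 2 + D1) &
            cond_exp_le P (G k)
              (fun omega => sigma k.+1 omega ^+ 2)
              (fun omega => 2 * C * gap k omega
                            + (1 - rho) * sigma k omega ^+ 2 + D2)]].

(* Main.v *)
Require Import Defs.
From HB Require Import structures.
From mathcomp Require Import all_boot all_order all_algebra.
From mathcomp Require Import all_classical all_reals all_analysis.
From mathcomp Require Import ring lra.
Set Implicit Arguments.
Unset Strict Implicit.
Unset Printing Implicit Defensive.
Import Order.TTheory GRing.Theory Num.Theory.
Import numFieldNormedType.Exports.
Local Open Scope classical_set_scope.
Local Open Scope ring_scope.

(* Before iteration k only the draws j_0, ..., j_(k-1) have been made, so the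
   history is the finite sigma-algebra generated by the tuple of these draws,
   and (x^k, w^k) is a function of that tuple. As j_k is uniform and independent
   of the tuple, E_k[f(x^k, w^k, j_k)] is the average of f(x^k, w^k, i) over i,
   which leaves three deterministic estimates at a fixed (x, w). The estimator
   averages to F(x). With b_i = F_i(w_i) - F_i(x^* ), its deviation from F(x^* )
   is F_i(x) - F_i(x^* ) plus the centred term (mean of b) - b_i; the bound
   |u + v|^2 <= 2|u|^2 + 2|v|^2 and variance <= second moment give the second
   inequality. For sigma, one of the n table entries is refreshed, each with
   probability 1/n. *)

(** * Integration of random variables with finitely many values *)

Section FiniteValued.
Context (dT : measure_display) (T : measurableType dT) (R : realType).
Context (P : probability T R) (S : finType) (h : T -> S).
Hypothesis mh : forall s, measurable (h @^-1` [set s]).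

Lemma measurable_preimage_fin (A : set S) : measurable (h @^-1` A).
Proof.
have -> : h @^-1` A = \bigcup_(s in A) h @^-1` [set s].
  by apply/seteqP; split => [w Aw|w [s As /= ->] //]; exists (h w).
by apply: fin_bigcup_measurable => //; exact: finite_finset.
Qed.

(** Reduces integrability and integrals of [f \o h] to those of indicators: at each point only the
    term [s = h w] survives. *)
Lemma fin_compE (f : S -> R) :
  EFin \o (f \o h) = fun w => (\sum_s ((f s)%:E * (\1_(h @^-1` [set s]) w)%:E))%E.
Proof.
apply/funext => w /=; rewrite (bigD1 (h w)) //= big1 => [|s sh]; last first.
  by rewrite indicE memNset ?mule0//= => /esym/eqP; apply/negP.
by rewrite indicE mem_set// mule1 adde0.
Qed.

Let integrable_term (f : S -> R) s :
  P.-integrable setT (fun w => (f s)%:E * (\1_(h @^-1` [set s]) w)%:E)%E.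
Proof. by apply: integrableZl => //; apply: integrable_indic. Qed.

Lemma integrable_fin_comp (f : S -> R) : P.-integrable setT (EFin \o (f \o h)).
Proof. by rewrite fin_compE; apply: integrable_sum. Qed.

Lemma integral_fin_comp (f : S -> R) :
  (\int[P]_w (f (h w))%:E = \sum_s (f s)%:E * P (h @^-1` [set s]))%E.
Proof.
have /(congr1 (fun g => integral P setT g)) := fin_compE f.
rewrite /= => ->; rewrite integral_sum//.
apply: eq_bigr => s _; rewrite integralZl//; last exact: integrable_indic.
by rewrite integral_indic// setIT.
Qed.

End FiniteValued.

Lemma cond_exp_independent_uniform (dT : measure_display)
    (T : measurableType dT) (R : realType) (P : probability T R) (S : finType)
    (n : nat) (h : T -> S) (J : T -> 'I_n) (f : S -> 'I_n -> R) :
    (forall s, measurable (h @^-1` [set s])) ->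
    (forall i, measurable (J @^-1` [set i])) ->
    (forall s i, P (h @^-1` [set s] `&` J @^-1` [set i]) =
                 ((n%:R^-1)%:E * P (h @^-1` [set s]))%E) ->
  is_cond_expectation P (preimage_set_system setT h setT)
    (fun w => f (h w) (J w)) (fun w => n%:R^-1 * \sum_(i < n) f (h w) i).
Proof.
move=> mh mJ hJ.
pose hJw w := (h w, J w).
have hJwE s : hJw @^-1` [set s] = h @^-1` [set s.1] `&` J @^-1` [set s.2].
  by case: s => s i; apply/seteqP; split => w /=; rewrite /hJw => -[-> ->].
have mhJ s : measurable (hJw @^-1` [set s]) by rewrite hJwE; apply: measurableI.
pose f2 (s : S * 'I_n) := f s.1 s.2.
pose m s := n%:R^-1 * \sum_(i < n) f s i.
(* Absorbing the domain as a factor [\1_A (h w)] keeps the integrand a function of [h] or of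
   [(h, J)], so [integral_fin_comp] applies. *)
have restr (A : set S) (g : T -> R) :
    (\int[P]_(w in h @^-1` A) (g w)%:E = \int[P]_w (\1_A (h w) * g w)%:E)%E.
  rewrite integral_mkcond; apply: eq_integral => w _; rewrite patchE indicE.
  have [/set_mem wA|/negP wA] := boolP (w \in _).
    by rewrite mem_set ?mul1r.
  rewrite memNset ?mul0r// => hA; apply: wA; exact/mem_set.
split.
- exact: (integrable_fin_comp P mhJ f2).
- exact: (integrable_fin_comp P mh m).
- move=> B _; exists (m @^-1` B) => //.
  by rewrite setTI -comp_preimage.
- move=> _ [A _ <-]; rewrite setTI !restr.
  rewrite (integral_fin_comp P mh (fun s => \1_A s * m s)).
  rewrite (integral_fin_comp P mhJ (fun s => \1_A s.1 * f2 s)).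
  transitivity (\sum_s \sum_i (\1_A s * f s i)%:E * P (hJw @^-1` [set (s, i)]))%E;
    last by rewrite pair_bigA; apply: eq_bigr => -[].
  apply: eq_bigr => s _.
  under eq_bigr do rewrite hJwE /= hJ muleA -EFinM.
  have [p ->] : exists p : R, P (h @^-1` [set s]) = p%:E.
    by exists (fine (P (h @^-1` [set s]))); rewrite fineK// fin_num_measure.
  rewrite sumEFin -EFinM; congr EFin.
  rewrite /m mulrA mulr_sumr mulr_suml; apply: eq_bigr => i _; ring.
Qed.

(** * The history as the sigma-algebra of a tuple of draws *)

Section Draws.
Context (dT : measure_display) (T : measurableType dT) (n : nat).
Variables (j : nat -> T -> 'I_n).

Definition draws (k : nat) (w : T) : k.-tuple 'I_n := [tuple j l w | l < k].

Lemma nth_draws i0 k w l : (l < k)%N -> nth i0 (draws k w) l = j l w.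
Proof. by move=> lk; rewrite (nth_mktuple _ i0 (Ordinal lk)). Qed.

(** Puts the atoms of the history in the form used by [draw_independent]; [i0] is only the default
    of [nth]. *)
Lemma draws_preimage1 i0 k (s : k.-tuple 'I_n) :
  draws k @^-1` [set s] =
  \bigcap_(l in [set` iota 0 k]) (j l @^-1` [set nth i0 s l]).
Proof.
apply/seteqP; split => w /=.
  by move=> <- l /=; rewrite mem_iota /= add0n => lk; rewrite nth_draws.
move=> sw; apply/val_inj/(@eq_from_nth _ i0); rewrite ?size_tuple// => l lk.
by rewrite nth_draws// sw //= mem_iota.
Qed.

(** Each generator constrains one coordinate of the tuple, and preimages form a sigma-algebra.
    Conversely, a preimage is a finite union of atoms, each a finite intersection of generators. *)
Lemma history_draws k :
  history j k = preimage_set_system setT (draws k) setT.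
Proof.
apply/seteqP; split.
  apply: smallest_sub.
    by apply: sigma_algebra_preimage; split.
  move=> _ [l [A [lk ->]]].
  exists [set s : k.-tuple 'I_n | A (tnth s (Ordinal lk))] => //.
  by rewrite setTI; apply/seteqP; split => w /=; rewrite tnth_mktuple.
move=> _ [A _ <-]; rewrite setTI.
pose gen : set (set T) :=
  [set E | exists l (A : set 'I_n), (l < k)%N /\ E = j l @^-1` A].
(* [T] is re-equipped with the sigma-algebra generated by [gen], so that measurable now means
   belonging to the history. *)
apply: (@measurable_preimage_fin _ (g_sigma_algebraType gen)) => s.
have i0 : 'I_n := j 0 point.
rewrite (draws_preimage1 i0).
apply: fin_bigcap_measurable => // l; rewrite /= mem_iota /= add0n => lk.
by apply: sub_sigma_algebra; exists l, [set nth i0 s l].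
Qed.

End Draws.

Lemma cond_exp_draw (dT : measure_display) (T : measurableType dT)
    (R : realType) (P : probability T R) (n : nat) (j : nat -> T -> 'I_n)
    (k : nat) (f : k.-tuple 'I_n -> 'I_n -> R) :
    iid_uniform P j ->
  is_cond_expectation P (history j k)
    (fun w => f (draws j k w) (j k w))
    (fun w => n%:R^-1 * \sum_(i < n) f (draws j k w) i).
Proof.
case=> mj uj ij; rewrite history_draws.
have i0 : 'I_n := j 0 point.
apply: cond_exp_independent_uniform => // s.
  rewrite (draws_preimage1 _ i0).
  by apply: fin_bigcap_measurable => // l _; exact: mj.
(* A single family [A] encodes both events, so independence is used twice: over [iota 0 k] and over
   [k :: iota 0 k]. The two products differ by the factor at [k], which is 1/n. *)
move=> i; pose A l := [set nth i0 (rcons s i) l].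
have As l : (l < k)%N -> A l = [set nth i0 s l].
  by move=> lk; rewrite /A nth_rcons size_tuple lk.
have Ak : A k = [set i] by rewrite /A nth_rcons size_tuple ltnn eqxx.
have sE : draws j k @^-1` [set s] = \bigcap_(l in [set` iota 0 k]) (j l @^-1` A l).
  rewrite (draws_preimage1 _ i0); apply: eq_bigcapr => l.
  by rewrite /= mem_iota => /As ->.
have ksE : draws j k @^-1` [set s] `&` j k @^-1` [set i] =
    \bigcap_(l in [set` k :: iota 0 k]) (j l @^-1` A l).
  rewrite sE setIC -Ak -(bigcap_setU1 (fun l => j l @^-1` A l)); congr (\bigcap_(l in _) _).
  apply/seteqP; split => l /=; rewrite inE; first by case=> [->|->]; rewrite ?eqxx ?orbT.
  by case/orP => [/eqP|]; [left|right].
rewrite ksE sE !ij ?iota_uniq//= ?mem_iota ?iota_uniq ?ltnn ?andbF//.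
by rewrite big_cons Ak uj.
Qed.

(** * Euclidean inequalities, taken coordinate by coordinate *)

Section EuclideanNorm.
Context (R : realType) (d : nat).
Implicit Types u v : 'rV[R]_d.

Lemma norm2_sqrE u : norm2 u ^+ 2 = \sum_(c < d) u 0 c ^+ 2.
Proof. by rewrite sqr_sqrtr// sumr_ge0// => c _; rewrite -expr2 sqr_ge0. Qed.

Lemma norm2_sqrD_le u v :
  norm2 (u + v) ^+ 2 <= 2 * norm2 u ^+ 2 + 2 * norm2 v ^+ 2.
Proof.
rewrite !norm2_sqrE !mulr_sumr -big_split ler_sum//= => c _.
by rewrite mxE; have := sqr_ge0 (u 0 c - v 0 c); nra.
Qed.

Lemma norm2_variance_le (n : nat) (b : 'I_n -> 'rV[R]_d) : (0 < n)%N ->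
  \sum_(i < n) norm2 (n%:R^-1 *: (\sum_(l < n) b l) - b i) ^+ 2
    <= \sum_(i < n) norm2 (b i) ^+ 2.
Proof.
move=> n_gt0.
under eq_bigr do rewrite norm2_sqrE.
under [leRHS]eq_bigr do rewrite norm2_sqrE.
rewrite exchange_big [leRHS]exchange_big ler_sum//= => c _.
set m := n%:R^-1 * \sum_(l < n) b l 0 c.
have nm : n%:R * m = \sum_(l < n) b l 0 c.
  by rewrite mulrA divff ?mul1r// pnatr_eq0 -lt0n.
have -> : \sum_(i < n) (n%:R^-1 *: (\sum_(l < n) b l) - b i) 0 c ^+ 2 =
    \sum_(i < n) (m ^+ 2 - 2 * m * b i 0 c + b i 0 c ^+ 2).
  by apply: eq_bigr => i _; rewrite !mxE summxE -/m; ring.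
(* The terms other than the squares of [b i] add up to n m^2 - 2 m (n m) = - n m^2. *)
rewrite big_split /= gerDr sumrB sumr_const card_ord -mulr_sumr -nm -mulr_natl.
have : 0 <= n%:R * m ^+ 2 by rewrite mulr_ge0 ?sqr_ge0.
by lra.
Qed.

(** The minimizer exists and is unique, so [xget] does not fall back on its default [x]. *)
Lemma set_proj1 (a x : 'rV[R]_d) : set_proj [set a] x = a.
Proof.
apply: xget_subset1; first by split => // z ->.
by move=> y z [-> _] [-> _].
Qed.

End EuclideanNorm.

Lemma eq_saga_state (R : realType) (d n : nat)
    (Fs : 'I_n -> 'rV[R]_d -> 'rV[R]_d) (r : 'rV[R]_d -> \bar R) (gamma : R)
    (x0 : 'rV[R]_d) (js js' : nat -> 'I_n) (k : nat) :
    (forall l, (l < k)%N -> js l = js' l) ->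
  saga_state Fs r gamma x0 js k = saga_state Fs r gamma x0 js' k.
Proof.
elim: k => //= k IHk jsE; rewrite IHk => [|l lk]; last by rewrite jsE// ltnS ltnW.
by case: saga_state => x w; rewrite jsE.
Qed.

(** * Averages over the drawn index at a fixed state *)

Section OneStep.
Context (R : realType) (d n : nat) (Fs : 'I_n -> 'rV[R]_d -> 'rV[R]_d).
Hypothesis n_gt0 : (0 < n)%N.
Implicit Types (x a : 'rV[R]_d) (w : 'I_n -> 'rV[R]_d).

Let n_neq0 : n%:R != 0 :> R. Proof. by rewrite pnatr_eq0 -lt0n. Qed.

Lemma mean_saga_estimator x w c :
  n%:R^-1 * \sum_(i < n) saga_estimator Fs x w i 0 c = mean_op Fs x 0 c.
Proof.
have -> : n%:R^-1 * \sum_(i < n) saga_estimator Fs x w i 0 c =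
    (n%:R^-1 *: \sum_(i < n) saga_estimator Fs x w i) 0 c by rewrite mxE summxE.
rewrite big_split sumrB /= sumr_const card_ord -[(_ *: _) *+ n]scaler_nat.
by rewrite scalerA divff// scale1r subrK.
Qed.

Lemma saga_estimator_second_moment x w a :
  n%:R^-1 * \sum_(i < n) norm2 (saga_estimator Fs x w i - mean_op Fs a) ^+ 2
    <= 2 * (n%:R^-1 * \sum_(i < n) norm2 (Fs i x - Fs i a) ^+ 2)
     + 2 * (n%:R^-1 * \sum_(i < n) norm2 (Fs i (w i) - Fs i a) ^+ 2).
Proof.
rewrite ![2 * (_ * _)]mulrCA -mulrDr ler_wpM2l//.
pose b i := Fs i (w i) - Fs i a.
(* [mean_op Fs a] is the average of the [Fs l a]; subtracting it turns the table mean into the mean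
   of [b]. *)
have estE i : saga_estimator Fs x w i - mean_op Fs a =
    (Fs i x - Fs i a) + (n%:R^-1 *: (\sum_(l < n) b l) - b i).
  rewrite /saga_estimator /mean_op /b sumrB scalerBr.
  apply/rowP => c; rewrite !mxE; ring.
under eq_bigr do rewrite estE.
apply: (@le_trans _ _ (\sum_(i < n) (2 * norm2 (Fs i x - Fs i a) ^+ 2
  + 2 * norm2 (n%:R^-1 *: (\sum_(l < n) b l) - b i) ^+ 2))).
  by apply: ler_sum => i _; exact: norm2_sqrD_le.
rewrite big_split /= -!mulr_sumr lerD2l ler_pM2l//.
exact: norm2_variance_le.
Qed.

(** Refreshing entry [i] changes the sum of the table by [a i - b i], and each index is refreshed
    for exactly one [i]. *)
Lemma mean_saga_table_update (a b : 'I_n -> R) :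
  n%:R^-1 * \sum_(i < n) (n%:R^-1 * \sum_(l < n) (if l == i then a l else b l))
  = n%:R^-1 * (n%:R^-1 * \sum_(l < n) a l)
    + (1 - n%:R^-1) * (n%:R^-1 * \sum_(l < n) b l).
Proof.
have rowE i : \sum_(l < n) (if l == i then a l else b l)
    = a i - b i + \sum_(l < n) b l.
  rewrite (bigD1 i) //= eqxx [in RHS](bigD1 i)//= addrA subrK; congr (_ + _).
  by apply: eq_bigr => l /negbTE ->.
under eq_bigr do rewrite rowE.
rewrite -mulr_sumr big_split sumrB /= sumr_const card_ord -mulr_natl.
by field.
Qed.

End OneStep.

(** * Conditional expectations along the iteration *)

Section SagaExpectation.
Context (R : realType) (d n : nat) (Fs : 'I_n -> 'rV[R]_d -> 'rV[R]_d).
Context (r : 'rV[R]_d -> \bar R) (gamma : R) (x0 : 'rV[R]_d).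
Context (dT : measure_display) (T : measurableType dT) (P : probability T R).
Variable j : nat -> T -> 'I_n.
Local Notation x := (saga_x Fs r gamma x0 j).
Local Notation w := (saga_w Fs r gamma x0 j).
Local Notation sigma := (saga_sigma Fs r gamma x0 j).

(** A general [f] lets one statement serve the estimator, its squared deviation and the next
    [sigma]. *)
Lemma cond_exp_saga (k : nat)
    (f : 'rV[R]_d -> ('I_n -> 'rV[R]_d) -> 'I_n -> R) :
    iid_uniform P j ->
  is_cond_expectation P (history j k)
    (fun omega => f (x k omega) (w k omega) (j k omega))
    (fun omega => n%:R^-1 * \sum_(i < n) f (x k omega) (w k omega) i).
Proof.
move=> j_iid; have i0 : 'I_n := j 0 point.
(* The tuple is extended to a sequence by [i0]; the state at step [k] reads only indices below
   [k]. *)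
pose state (s : k.-tuple 'I_n) := saga_state Fs r gamma x0 (nth i0 s) k.
have stateE omega : saga_state Fs r gamma x0 (j ^~ omega) k = state (draws j k omega).
  by apply: eq_saga_state => l lk; rewrite nth_draws.
have := cond_exp_draw (fun s => f (state s).1 (state s).2) j_iid.
under eq_fun do rewrite -stateE.
by under [X in is_cond_expectation _ _ _ X]eq_fun do rewrite -stateE.
Qed.

Lemma saga_sigma_sqr a k omega : sigma a k omega ^+ 2 =
  n%:R^-1 * \sum_(i < n) norm2 (Fs i (w k omega i) - Fs i a) ^+ 2.
Proof. by rewrite sqr_sqrtr// mulr_ge0// sumr_ge0// => i _; rewrite sqr_ge0. Qed.

Lemma saga_wS k omega i :
  w k.+1 omega i = if i == j k omega then x k omega else w k omega i.
Proof. by rewrite /saga_w /saga_x /=; case: saga_state. Qed.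

End SagaExpectation.

Theorem propositionF12 (R : realType) (d n : nat)
  (Fs : 'I_n -> 'rV[R]_d -> 'rV[R]_d) (r : 'rV[R]_d -> \bar R)
  (gamma : R) (x0 xstar : 'rV[R]_d) (ell : R)
  (dT : measure_display) (T : measurableType dT) (P : probability T R)
  (j : nat -> T -> 'I_n)
  (n_gt0 : (0 < n)%N)
  (r_proper : proper_fun r)
  (r_lsc : lower_semicontinuous r)
  (r_convex : convex_efun r)
  (gamma_gt0 : 0 < gamma)
  (j_iid : iid_uniform P j)
  (ell_gt0 : 0 < ell)
  (Fs_ell : forall x : 'rV[R]_d,
     let xs := set_proj (vi_solutions (mean_op Fs) r) x in
     n%:R^-1 * \sum_(i < n) norm2 (Fs i x - Fs i xs) ^+ 2
       <= ell * dotp (mean_op Fs x - mean_op Fs xs) (x - xs))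
  (X_singleton : vi_solutions (mean_op Fs) r = [set xstar]) :
  key_parametric_assumption P (history j) (mean_op Fs)
    (vi_solutions (mean_op Fs) r)
    (saga_x Fs r gamma x0 j) (saga_g Fs r gamma x0 j)
    (saga_sigma Fs r gamma x0 j xstar)
    (* A *) ell (* B *) 2 (* C *) (ell / (2 * n%:R))
    (* D1 *) 0 (* D2 *) 0 (* rho *) n%:R^-1.
Proof.
rewrite X_singleton in Fs_ell *.
have {}Fs_ell x : n%:R^-1 * \sum_(i < n) norm2 (Fs i x - Fs i xstar) ^+ 2
    <= ell * dotp (mean_op Fs x - mean_op Fs xstar) (x - xstar).
  by have := Fs_ell x; rewrite set_proj1.
split.
- by split; rewrite ?divr_ge0 ?mulr_ge0 ?(ltW ell_gt0).
- by rewrite invr_gt0 ltr0n n_gt0 invf_le1 ?ltr0n// ler1n.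
- by move=> k omega; exact: sqrtr_ge0.
move=> k; split.
- move=> c.
  have := cond_exp_saga Fs r gamma x0 k (fun x w i => saga_estimator Fs x w i 0 c) j_iid.
  by under [X in is_cond_expectation _ _ _ X]eq_fun do rewrite mean_saga_estimator//.
(* The average over the index is an explicit version of the conditional expectation, and the bound
   on it holds at every [omega]. *)
- pose f x w i := norm2 (saga_estimator Fs x w i - mean_op Fs xstar) ^+ 2.
  exists (fun omega => n%:R^-1 * \sum_(i < n)
      f (saga_x Fs r gamma x0 j k omega) (saga_w Fs r gamma x0 j k omega) i).
    have := cond_exp_saga Fs r gamma x0 k f j_iid.
    by under [X in _ -> is_cond_expectation _ _ X _]eq_fun do rewrite set_proj1.
  apply/aeW => omega; rewrite set_proj1 saga_sigma_sqr addr0.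
  apply: le_trans (saga_estimator_second_moment _ n_gt0 _ _ _) _.
  (* The table terms match with B = 2; the rest is twice [Fs_ell], hence A = [ell]. *)
  by rewrite lerD2r -mulrA ler_pM2l.
(* The next squared [sigma] as a function of the current state and the drawn index [i]. *)
- pose f x (w : 'I_n -> 'rV[R]_d) i := n%:R^-1 * \sum_(l < n)
    (if l == i then norm2 (Fs l x - Fs l xstar) ^+ 2
     else norm2 (Fs l (w l) - Fs l xstar) ^+ 2).
  exists (fun omega => n%:R^-1 * \sum_(i < n)
      f (saga_x Fs r gamma x0 j k omega) (saga_w Fs r gamma x0 j k omega) i).
    have := cond_exp_saga Fs r gamma x0 k f j_iid.
    congr is_cond_expectation; apply/funext => omega.
    rewrite saga_sigma_sqr /f; congr (_ * _); apply: eq_bigr => l _.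
    by rewrite saga_wS; case: ifP.
  apply/aeW => omega; rewrite set_proj1 saga_sigma_sqr addr0.
  rewrite mean_saga_table_update// lerD2r.
  (* The refreshed entries have weight 1/n and [Fs_ell] bounds their mean, so 2C = [ell]/n. *)
  have -> : 2 * (ell / (2 * n%:R)) = n%:R^-1 * ell.
    by field; rewrite pnatr_eq0 -lt0n.
  by rewrite -mulrA ler_wpM2l.
Qed.
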